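(* Let $q>0$, $q\ne1$, $N\in\mathbb{Z}_{\ge0}$, $x,y\in\{0,\dots,N\}$, and let $s,t,v\in\mathbb{C}$ be such that no denominator in the coefficients below vanishes (automatic if $t\in\mathbb{R}$). Then $R_{\mathrm r}(x,y)=R_{\mathrm r}(x,y;s,t,v,N;q)$ satisfies $$[2x-N+s]_q\Big(a_{-1}(y,t)R_{\mathrm r}(x,y-1)+a_0(y,t)R_{\mathrm r}(x,y)+a_1(y,t)R_{\mathrm r}(x,y+1)\Big)$$ $$=b_{-1}(y,t)R_{\mathrm r}(x,y-1)+\big(b_0(y,t)+[s]_q\big)R_{\mathrm r}(x,y)+b_1(y,t)R_{\mathrm r}(x,y+1),$$ where terms involving $R_{\mathrm r}(x,-1)$ or $R_{\mathrm r}(x,N+1)$ are omitted (their coefficients are zero).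
   Context: $q^z=e^{z\log q}$; $[z]_q=\frac{q^z-q^{-z}}{q-q^{-1}}$, $\{z\}_q=\frac{q^z+q^{-z}}{q+q^{-1}}$; $(\alpha;p)_n=\prod_{i=0}^{n-1}(1-\alpha p^i)$, $(\alpha_1,\dots,\alpha_m;p)_n=\prod_i(\alpha_i;p)_n$; $\begin{bmatrix}N\\ n\end{bmatrix}_{p}=\frac{(p;p)_N}{(p;p)_n(p;p)_{N-n}}$. For $u,s\in\mathbb{C}$ and $n,x\in\{0,\dots,N\}$, $$k_{u,s}(n,x)=(-1)^nq^{n(s-u-\frac12N+\frac12)}\sum_{j=0}^{\min(n,x)}\frac{(q^{2n},\,q^{2x},\,-q^{-2x-2s+2N};q^{-2})_j}{(q^{2N},\,q^{-2};q^{-2})_j}q^{-2j},\qquad w(n)=q^{n(n-N)}\begin{bmatrix}N\\ n\end{bmatrix}_{q^2},$$ $$R_{\mathrm r}(x,y;s,t,v,N;q)=\sum_{n=0}^N k_{1,s}(n,x)\,k_{v,t}(n,y)\,w(n).$$ Coefficients: $$a_{-1}(y,t)=-\frac{q^{-4y-2t+3N+2}(1-q^{-2y})(1+q^{-2y-2t})}{(1+q^{-4y-2t+2N+2})(1+q^{-4y-2t+2N})},\qquad a_1(y,t)=\frac{q^{-N}(1-q^{-2y+2N})(1+q^{-2y-2t+2N})}{(1+q^{-4y-2t+2N})(1+q^{-4y-2t+2N-2})},$$ $$a_0(y,t)=q^{-N}-a_{-1}(y,t)-a_1(y,t),$$ $$b_{-1}(y,t)=a_{-1}(y,t)[2y-N+t+v-1]_q,\quad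 b_0(y,t)=a_0(y,t)[2y-N+t]_q\{v\}_q-[t]_q\{v\}_q,\quad b_1(y,t)=a_1(y,t)[2y-N+t-v+1]_q.$$ *)

(* Defs.v *)
From mathcomp Require Import all_boot all_order all_algebra.
From mathcomp Require Import complex.
From mathcomp Require Import reals sequences exp trigo.

Set Implicit Arguments.
Unset Strict Implicit.
Unset Printing Implicit Defensive.

Import Order.TTheory GRing.Theory Num.Theory.
Local Open Scope ring_scope.
Local Open Scope complex_scope.

Section QRacah.
Variable R : realType.
Implicit Types (q : R) (z s t u v alpha p : R[i]) (n x y N : nat).

Definition expC z : R[i] :=
  (expR (complex.Re z))%:C * (cos (complex.Im z) +i* sin (complex.Im z)).

Definition qpow q z : R[i] := expC (z * (ln q)%:C).

Definition qbracket q z : R[i] :=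
  (qpow q z - qpow q (- z)) / (q%:C - q%:C^-1).

Definition qbrace q z : R[i] :=
  (qpow q z + qpow q (- z)) / (q%:C + q%:C^-1).

Definition qpoch alpha p n : R[i] := \prod_(i < n) (1 - alpha * p ^+ i).

(* The truncated subtraction N - n is only used for n <= N. *)
Definition qbinom p N n : R[i] :=
  qpoch p p N / (qpoch p p n * qpoch p p (N - n)).

Definition kfun q N u s n x : R[i] :=
  let p := q%:C ^- 2 in
  (-1) ^+ n * qpow q (n%:R * (s - u - 2^-1 * N%:R + 2^-1)) *
  \sum_(j < (minn n x).+1)
    qpoch (qpow q (2 * n%:R)) p j * qpoch (qpow q (2 * x%:R)) p j *
    qpoch (- qpow q (- (2 * x%:R) - 2 * s + 2 * N%:R)) p j /
    (qpoch (qpow q (2 * N%:R)) p j * qpoch p p j) *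
    qpow q (- (2 * j%:R)).

Definition wfun q N n : R[i] :=
  qpow q (n%:R * (n%:R - N%:R)) * qbinom (q%:C ^+ 2) N n.

Definition Rr q N s t v x y : R[i] :=
  \sum_(n < N.+1) kfun q N 1 s n x * kfun q N v t n y * wfun q N n.

(* [den q N y t c] is 1 + q^(-4y - 2t + 2N + c), for c = 2, 0, -2. *)
Definition den q N y t (c : R[i]) : R[i] :=
  1 + qpow q (- (4 * y%:R) - 2 * t + 2 * N%:R + c).

Definition nonvanishing_den q N y t : Prop :=
  [/\ den q N y t 2 != 0, den q N y t 0 != 0 & den q N y t (- 2) != 0].

Definition a_m1 q N y t : R[i] :=
  - (qpow q (- (4 * y%:R) - 2 * t + 3 * N%:R + 2) *
     (1 - qpow q (- (2 * y%:R))) * (1 + qpow q (- (2 * y%:R) - 2 * t)) /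
     (den q N y t 2 * den q N y t 0)).

Definition a_1 q N y t : R[i] :=
  qpow q (- N%:R) * (1 - qpow q (- (2 * y%:R) + 2 * N%:R)) *
  (1 + qpow q (- (2 * y%:R) - 2 * t + 2 * N%:R)) /
  (den q N y t 0 * den q N y t (- 2)).

Definition a_0 q N y t : R[i] :=
  qpow q (- N%:R) - a_m1 q N y t - a_1 q N y t.

Definition b_m1 q N y t v : R[i] :=
  a_m1 q N y t * qbracket q (2 * y%:R - N%:R + t + v - 1).

Definition b_0 q N y t v : R[i] :=
  a_0 q N y t * qbracket q (2 * y%:R - N%:R + t) * qbrace q v
  - qbracket q t * qbrace q v.

Definition b_1 q N y t v : R[i] :=
  a_1 q N y t * qbracket q (2 * y%:R - N%:R + t - v + 1).

(* R_r(x, y - 1) and R_r(x, y + 1), with the out-of-range values R_r(x, -1) and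
   R_r(x, N + 1) set to 0, so that the terms containing them are omitted. *)
Definition Rr_pred q N s t v x y : R[i] :=
  if y is y'.+1 then Rr q N s t v x y' else 0.

Definition Rr_succ q N s t v x y : R[i] :=
  if (y < N)%N then Rr q N s t v x y.+1 else 0.

End QRacah.

(* Main.v *)
Require Import Defs.
From mathcomp Require Import all_boot all_order all_algebra.
From mathcomp Require Import complex.
From mathcomp Require Import reals sequences exp trigo.
From mathcomp Require Import ring zify.

Import Order.TTheory GRing.Theory Num.Theory.
Local Open Scope ring_scope.
Local Open Scope complex_scope.

(** Put [p = q^-2].  The operator [A] with coefficients [a_-1, a_0, a_1] is the
    second-order [q]-difference operator diagonalised by the dual q-Krawtchouk
    polynomials: [A k_(v,t)(n,.) = q^(2n-N) k_(v,t)(n,.)], while multiplication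
    by [[2y-N+t]_q], called [L_t] here, acts on [n -> k_(v,t)(n,y)] by the
    three-term recurrence.
    The operator with coefficients [b_i] is [al L_t A + be A L_t - [t]_q {v}_q]
    where [al q + be/q = q^v] and [al/q + be q = q^-v] (so [al + be = {v}_q]).
    On the left-hand side, expand [[2x-N+s]_q k_(1,s)(n,x)] by the three-term
    recurrence; on the right-hand side expand both products of [L_t] and [A];
    comparing the coefficients of [k_(1,s)(m,x) k_(v,t)(n,y)] with
    [|m - n| <= 1] is then an elementary identity for the weight [w].  *)

(** * Finite q-shifted factorials and the dual q-Krawtchouk sum *)

(* The same as [qpoch], over an arbitrary field. *)
Definition poch {F : fieldType} (a p : F) (n : nat) : F :=
  \prod_(i < n) (1 - a * p ^+ i).

(* With [z = p^-n], [X = p^-x], [M = p^-N], [c = - p^(s-N)], the dual q-Krawtchouk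
   polynomial; keeping [z] and [X] free lets the shifts of [n] and [x] leave
   the range [0..N].  The sum has [m] terms, so [m = N.+1] below. *)
Definition kraw {F : fieldType} (p M c : F) (m : nat) (z X : F) : F :=
  \sum_(j < m) poch z p j * poch X p j * poch (c / X) p j /
    (poch M p j * poch p p j) * p ^+ j.

Lemma poch0 (F : fieldType) (a p : F) : poch a p 0 = 1.
Proof. exact: big_ord0. Qed.

Lemma pochS (F : fieldType) (a p : F) n :
  poch a p n.+1 = poch a p n * (1 - a * p ^+ n).
Proof. exact: big_ord_recr. Qed.

Lemma pochSl (F : fieldType) (a p : F) n :
  poch a p n.+1 = (1 - a) * poch (a * p) p n.
Proof.
rewrite /poch big_ord_recl expr0 mulr1; congr (_ * _).
by apply: eq_bigr => i _; rewrite exprS mulrA.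
Qed.

Lemma poch_eq0 (F : fieldType) (a p : F) n k :
  (k < n)%N -> a * p ^+ k = 1 -> poch a p n = 0.
Proof.
by move=> lt_kn ak; rewrite /poch (bigD1 (Ordinal lt_kn)) //= ak subrr mul0r.
Qed.

Lemma poch_neq0 (F : fieldType) (a p : F) n :
  (forall k, (k < n)%N -> a * p ^+ k != 1) -> poch a p n != 0.
Proof.
move=> ak; apply/prodf_neq0 => i _; rewrite subr_eq0 eq_sym.
exact: ak.
Qed.

Lemma poch_neq0_le (F : fieldType) (a p : F) m n :
  (m <= n)%N -> poch a p n != 0 -> poch a p m != 0.
Proof.
move=> le_mn /prodf_neq0 an; apply/prodf_neq0 => i _.
exact: (an (widen_ord le_mn i)).
Qed.

(** * The three-term recurrence in [z] *)

Lemma krawS (F : fieldType) (p M c z X : F) m :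
  kraw p M c m.+1 z X = kraw p M c m z X +
    poch z p m * poch X p m * poch (c / X) p m /
      (poch M p m * poch p p m) * p ^+ m.
Proof. exact: big_ord_recr. Qed.

(* The extra term is the boundary term of a telescoping sum; it vanishes for
   [m = N] because [X = p^-x] with [x <= N]. *)
Lemma kraw_rec_trunc (F : fieldType) (p M c z X : F) m :
    p != 0 -> z != 0 -> X != 0 -> poch M p m != 0 -> poch p p m != 0 ->
  (X + c / X) * kraw p M c m.+1 z X
    + poch z p m / (poch M p m * poch p p m)
       * (poch X p m.+1 * poch (c / X) p m.+1)
  = (1 - M / z) * kraw p M c m.+1 (z / p) X
    + (M + c) / z * kraw p M c m.+1 z X
    + c * (1 - z^-1) * kraw p M c m.+1 (z * p) X.
Proof.
move=> p0 z0 X0; elim: m => [|m IHm] Mm pm.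
  rewrite /kraw !big_ord1 !pochS !poch0 !expr0.
  by field; rewrite oner_neq0 z0 X0.
(* Both shifts of [z] are reduced to [poch z p m]; the coefficient [1 - z^-1] supplies the factor
   [1 - z] that the product starting at [z * p] lacks. *)
have zp : (1 - z) * poch (z * p) p m.+1 =
    poch z p m * (1 - z * p ^+ m) * (1 - z * p ^+ m.+1).
  by rewrite -pochSl !pochS.
have zd : poch (z / p) p m.+1 = (1 - z / p) * poch z p m.
  by rewrite pochSl divfK.
have /eqP := IHm (poch_neq0_le _ _ _ _ _ (leqnSn m) Mm)
                  (poch_neq0_le _ _ _ _ _ (leqnSn m) pm).
rewrite -subr_eq0 => /eqP {}IHm.
rewrite 3!(krawS _ _ _ _ _ _ m.+1) zd.
(* Subtracting the case [m] leaves only the summands of index [m.+1] and the two boundary terms. *)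
apply/eqP; rewrite -subr_eq0 -IHm -subr_eq0; apply/eqP.
have distr e k (P a b d r : F) :
    e * (k + P * a * b / d * r) = e * k + P * e * (a * b / d * r).
  by rewrite mulrDr; congr (_ + _); rewrite !mulrA (mulrC e).
rewrite (distr (c * (1 - z^-1))).
have {zp} -> : poch (z * p) p m.+1 * (c * (1 - z^-1)) =
  - c / z * poch z p m * (1 - z * p ^+ m) * (1 - z * p ^+ m.+1).
  rewrite -!(mulrA (- c / z)) -zp.
  by field; rewrite z0.
rewrite [in poch z p m.+1]pochS.
move: (poch X p m.+1) (pochS _ X p m.+1) => PX ->.
move: (poch (c / X) p m.+1) (pochS _ (c / X) p m.+1) => PcX ->.
move: Mm pm; rewrite ![poch _ p m.+1]pochS ![p ^+ m.+1]exprS.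
move: (poch z p m) (poch M p m) (poch p p m) (p ^+ m) => Pz PM Pp a.
rewrite !mulf_eq0 !negb_or => /andP[PM0 Ma] /andP[Pp0 pa].
by field; rewrite z0 Pp0 PM0 X0 pa Ma p0.
Qed.

Lemma kraw_rec (F : fieldType) (p M c z X : F) N x :
    p != 0 -> z != 0 -> X != 0 -> poch M p N != 0 -> poch p p N != 0 ->
    (x <= N)%N -> X * p ^+ x = 1 ->
  (X + c / X) * kraw p M c N.+1 z X =
    (1 - M / z) * kraw p M c N.+1 (z / p) X
    + (M + c) / z * kraw p M c N.+1 z X
    + c * (1 - z^-1) * kraw p M c N.+1 (z * p) X.
Proof.
move=> p0 z0 X0 MN pN le_xN Xx; rewrite -kraw_rec_trunc //.
by rewrite (poch_eq0 _ X p N.+1 x) // mul0r mulr0 addr0.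
Qed.

(** * The q-difference equation in [X] *)

(* Coefficients [B] and [D] of the difference equation in [x], with the factors
   [1 - c/X] and [1 - X] that absorb the shifted products put in front. *)
Definition kraw_up {F : fieldType} (p M c X : F) : F :=
  (1 - c / X) * ((1 - M / X) / ((1 - c / X ^+ 2) * (1 - c * p / X ^+ 2))).

Definition kraw_down {F : fieldType} (p M c X : F) : F :=
  (1 - X) * - (c / (p * X ^+ 3) * (M - c / X) /
    ((1 - c / X ^+ 2) * (1 - c / (p * X ^+ 2)))).

(** The contributions of the summands telescope, by induction on [m]. For [m = N] and [z = p^-n]
    with [n <= N] the remainder contains a vanishing factor, which gives [kraw_diff]. *)
Lemma kraw_diff_trunc (F : fieldType) (p M c z X : F) m :
    p != 0 -> X != 0 -> X ^+ 2 - c != 0 -> X ^+ 2 - c * p != 0 ->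
    p * X ^+ 2 - c != 0 -> poch M p m != 0 -> poch p p m != 0 ->
  kraw_up p M c X * kraw p M c m.+1 z (X / p)
  + (1 - kraw_up p M c X - kraw_down p M c X - z) * kraw p M c m.+1 z X
  + kraw_down p M c X * kraw p M c m.+1 z (X * p)
  = poch z p m.+1 * poch X p m * poch (c / X) p m / (poch M p m * poch p p m).
Proof.
move=> p0 X0 d0 d1 d2; elim: m => [|m IHm] Mm pm.
  rewrite /kraw !big_ord1 !pochS !poch0 !expr0.
  move: (kraw_up _ _ _ _) (kraw_down _ _ _ _) => B D.
  by field; rewrite oner_neq0.
have {}IHm := IHm (poch_neq0_le _ _ _ _ _ (leqnSn m) Mm)
                  (poch_neq0_le _ _ _ _ _ (leqnSn m) pm).
rewrite !(krawS _ _ _ _ _ _ m.+1).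
have distr3 a b c0 k1 k2 k3 t1 t2 t3 :
  a * (k1 + t1) + b * (k2 + t2) + c0 * (k3 + t3) =
  (a * k1 + b * k2 + c0 * k3) + (a * t1 + b * t2 + c0 * t3) :> F.
  by rewrite !mulrDr !(addrACA _ (_ * t1)) !(addrACA _ _ (c0 * k3)).
rewrite {}distr3 {}IHm.
have Xd : poch (X / p) p m.+1 = (1 - X / p) * poch X p m.
  by rewrite pochSl divfK.
(* Passing to [X / p] turns [c / X] into [c / X * p], whose product lacks the factor [1 - c / X];
   [kraw_up] carries it. In the same way [kraw_down] carries [1 - X]. *)
have cXd : (1 - c / X) * poch (c / (X / p)) p m.+1 =
    poch (c / X) p m * (1 - c / X * p ^+ m) * (1 - c / X * p ^+ m.+1).
  have -> : c / (X / p) = c / X * p by field; rewrite p0 X0.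
  by rewrite -pochSl !pochS.
have Xu : (1 - X) * poch (X * p) p m.+1 =
    poch X p m * (1 - X * p ^+ m) * (1 - X * p ^+ m.+1).
  by rewrite -pochSl !pochS.
have cXu : poch (c / (X * p)) p m.+1 = (1 - c / (X * p)) * poch (c / X) p m.
  by rewrite pochSl invfM mulrA divfK.
rewrite {}Xd {}cXu /kraw_up /kraw_down.
set B := (1 - M / X) / _; set D := - (_ * (M - c / X) / _).
have up u v r t a : (1 - c / X) * B * (u * v * r / t * a)
    = (1 - c / X) * r * (B * u * v / t * a) by move: t^-1 => t'; ring.
have down u v r t a : (1 - X) * D * (u * v * r / t * a)
    = (1 - X) * v * (D * u * r / t * a) by move: t^-1 => t'; ring.
rewrite {}up {}down {}cXd {}Xu /B /D.
move: Mm pm; rewrite ![poch _ p m.+2]pochS ![poch _ p m.+1]pochS.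
rewrite ![p ^+ m.+1]exprS.
move: (poch z p m) (poch M p m) (poch p p m) (p ^+ m) => Pz PM Pp a.
move: (poch X p m) (poch (c / X) p m) => PX PcX.
rewrite !mulf_eq0 !negb_or => /andP[PM0 Ma] /andP[Pp0 pa].
by field; rewrite pa Pp0 Ma PM0 X0 p0 d2 d0 d1.
Qed.

Lemma kraw_diff (F : fieldType) (p M c z X : F) N n :
    p != 0 -> X != 0 -> X ^+ 2 - c != 0 -> X ^+ 2 - c * p != 0 ->
    p * X ^+ 2 - c != 0 -> poch M p N != 0 -> poch p p N != 0 ->
    (n <= N)%N -> z * p ^+ n = 1 ->
  kraw_down p M c X * kraw p M c N.+1 z (X * p)
  + (1 - kraw_down p M c X - kraw_up p M c X) * kraw p M c N.+1 z X
  + kraw_up p M c X * kraw p M c N.+1 z (X / p)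
  = z * kraw p M c N.+1 z X.
Proof.
move=> p0 X0 d0 d1 d2 MN pN le_nN zn.
apply/eqP; rewrite -subr_eq0; apply/eqP.
have := kraw_diff_trunc _ p M c z X N p0 X0 d0 d1 d2 MN pN.
rewrite (poch_eq0 _ z p N.+1 n) // !mul0r => h; rewrite -[RHS]h.
by move: (kraw_up _ _ _ _) (kraw_down _ _ _ _) => B D; ring.
Qed.

(** * Comparing coefficients under the weighted sum *)

(** An index shift whose ends drop out: [U N = 0] removes the value of [f] at [N.+1], and [V 0 = 0]
    the index [0], where [n.-1] is truncated. *)
Lemma sum_shift (F : fieldType) (U V f g : nat -> F) N :
    U N = 0 -> V 0%N = 0 -> (forall n, (n < N)%N -> V n.+1 = U n) ->
  \sum_(n < N.+1) U n * f n.+1 * g n = \sum_(n < N.+1) V n * f n * g n.-1.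
Proof.
move=> UN V0 VS; rewrite big_ord_recr big_ord_recl /= UN V0 !mul0r addr0 add0r.
by apply: eq_bigr => i _; rewrite VS.
Qed.

(* Here [d n] are the eigenvalues of [A], and [gm], [g0], [gp] the values at
   [y - 1], [y], [y + 1].  The hypotheses on [gm] and [gp] carry the factors
   [am] and [ap] so that they hold trivially at the ends of the range. *)
Lemma bilinear_sum_relation (F : fieldType) (N : nat)
    (f gm g0 gp w d A1 A0 Am M1 M0 Mm : nat -> F)
    (S : (nat -> F) -> F) (Ls Lm L0 Lp am a0 ap al be kappa : F) :
    (forall g, S g = \sum_(n < N.+1) f n * g n * w n) ->
    (forall n, (n <= N)%N ->
       Ls * f n = A1 n * f n.+1 + A0 n * f n + Am n * f n.-1) ->
    (forall n, (n <= N)%N -> am * (Lm * gm n) =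
       am * (M1 n * gm n.+1 + M0 n * gm n + Mm n * gm n.-1)) ->
    (forall n, (n <= N)%N ->
       L0 * g0 n = M1 n * g0 n.+1 + M0 n * g0 n + Mm n * g0 n.-1) ->
    (forall n, (n <= N)%N -> ap * (Lp * gp n) =
       ap * (M1 n * gp n.+1 + M0 n * gp n + Mm n * gp n.-1)) ->
    (forall n, (n <= N)%N -> am * gm n + a0 * g0 n + ap * gp n = d n * g0 n) ->
    A1 N = 0 -> Am 0%N = 0 -> M1 N = 0 -> Mm 0%N = 0 ->
    (forall n, (n <= N)%N -> d n * A0 n = (al + be) * d n * M0 n + kappa) ->
    (forall n, (n < N)%N ->
       w n * d n * A1 n = w n.+1 * (al * d n.+1 + be * d n) * Mm n.+1) ->
    (forall n, (n < N)%N ->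
       w n.+1 * d n.+1 * Am n.+1 = w n * (al * d n + be * d n.+1) * M1 n) ->
  Ls * (am * S gm + a0 * S g0 + ap * S gp) =
    am * (al * L0 + be * Lm) * S gm
    + (a0 * (al + be) * L0 + kappa) * S g0
    + ap * (al * L0 + be * Lp) * S gp.
Proof.
move=> SE recf recm rec0 recp eig A1N Am0 M1N Mm0 diag up down.
have lin a b c u v t : a * S u + b * S v + c * S t =
    \sum_(n < N.+1) f n * (a * u n + b * v n + c * t n) * w n.
  rewrite !SE !mulr_sumr -!big_split; apply: eq_bigr => i _ /=; ring.
rewrite !{}lin mulr_sumr.
(* [eig] is available only up to [N]; at [n = N] the coefficient [M1 N = 0] takes over. *)
have eigS n : (n <= N)%N ->
    M1 n * (am * gm n.+1 + a0 * g0 n.+1 + ap * gp n.+1)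
    = M1 n * (d n.+1 * g0 n.+1).
  rewrite leq_eqVlt => /orP[/eqP->|lt_nN]; first by rewrite M1N !mul0r.
  by rewrite eig.
have eigP n : (n <= N)%N ->
    Mm n * (am * gm n.-1 + a0 * g0 n.-1 + ap * gp n.-1)
    = Mm n * (d n.-1 * g0 n.-1).
  by case: n => [|n] le_nN; [rewrite Mm0 !mul0r | rewrite eig // ltnW].
(* Left side: the eigenvalue equation for [g0], then the recurrence for [f]. *)
transitivity (\sum_(n < N.+1) (w n * d n * A1 n * f n.+1 * g0 n
   + (w n * d n * A0 n * f n * g0 n + w n * d n * Am n * g0 n * f n.-1))).
  apply: eq_bigr => i _; have le_iN : (i <= N)%N by rewrite -ltnS.
  rewrite eig // !mulrA recf //; ring.
transitivity (\sum_(n < N.+1) (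
   w n * (al * d n + be * d n.-1) * Mm n * f n * g0 n.-1
   + (w n * ((al + be) * d n * M0 n + kappa) * f n * g0 n
   + w n * (al * d n + be * d n.+1) * M1 n * g0 n.+1 * f n))); last first.
  apply: eq_bigr => i _; have le_iN : (i <= N)%N by rewrite -ltnS.
  (* In the [al] part the difference operator acts before the multiplication; in the [be] part the
     multiplications by [Lm], [L0], [Lp] come first. *)
  transitivity (f i * w i * (al * L0 * (am * gm i + a0 * g0 i + ap * gp i)
    + be * (am * (Lm * gm i) + a0 * (L0 * g0 i) + ap * (Lp * gp i))
    + kappa * g0 i));
    last by ring.
  rewrite recm // recp // {1}eig //.
  transitivity (f i * w i * (al * L0 * (d i * g0 i) + be *
     (M1 i * (am * gm i.+1 + a0 * g0 i.+1 + ap * gp i.+1)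
      + M0 i * (am * gm i + a0 * g0 i + ap * gp i)
      + Mm i * (am * gm i.-1 + a0 * g0 i.-1 + ap * gp i.-1)) + kappa * g0 i));
    last by rewrite rec0 //; ring.
  rewrite eigS // eigP // eig //.
  have -> : al * L0 * (d i * g0 i) = al * d i * (L0 * g0 i) by ring.
  by rewrite rec0 //; ring.
(* The diagonal parts agree termwise; the two outer ones agree after index shifts in opposite
   directions. *)
rewrite !big_split /=; congr (_ + (_ + _)).
- apply: (sum_shift _ (fun n => w n * d n * A1 n)
    (fun n => w n * (al * d n + be * d n.-1) * Mm n))
    => [||n lt_nN]; rewrite ?A1N ?Mm0 ?mulr0 //=.
  by rewrite up.
- by apply: eq_bigr => i _; rewrite -(mulrA (w i)) diag // -ltnS.
- apply/esym.
  apply: (sum_shift _ (fun n => w n * (al * d n + be * d n.+1) * M1 n)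
    (fun n => w n * d n * Am n)) => [||n lt_nN]; rewrite ?M1N ?Am0 ?mulr0 //=.
  by rewrite down.
Qed.

(** * The kernels and the weight as rational expressions in powers of [q] *)

(* [Q], [S] and [G] stand for [q], [q^s] and [q^(s-u-N/2+1/2)]. *)
Definition qker {F : fieldType} (Q G S : F) (N n x : nat) : F :=
  (- G) ^+ n * kraw (Q ^- 2) (Q ^+ (2 * N)) (- (Q ^+ (2 * N) / S ^+ 2)) N.+1
    (Q ^+ (2 * n)) (Q ^+ (2 * x)).

Definition qweight {F : fieldType} (Q : F) (N n : nat) : F :=
  Q ^+ (n * n) / Q ^+ (n * N) *
  (poch (Q ^+ 2) (Q ^+ 2) N /
    (poch (Q ^+ 2) (Q ^+ 2) n * poch (Q ^+ 2) (Q ^+ 2) (N - n))).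

(** The factors [G] and its inverse in [rec_down] and [rec_up] compensate the normalisation
    [(- G) ^+ n] of [qker]. *)
Definition rec_up {F : fieldType} (Q G S : F) (N n : nat) : F :=
  - (S / Q ^+ N / (Q - Q^-1) * (1 - Q ^+ (2 * N) / Q ^+ (2 * n)) / G).

Definition rec_diag {F : fieldType} (Q S : F) (N n : nat) : F :=
  (S - S^-1) / (Q - Q^-1) * (Q ^+ N / Q ^+ (2 * n)).

Definition rec_down {F : fieldType} (Q G S : F) (N n : nat) : F :=
  S^-1 * Q ^+ N / (Q - Q^-1) * (1 - Q ^- (2 * n)) * G.

Lemma expr_mulVX (F : fieldType) (Q : F) m k :
  Q != 0 -> (k <= m)%N -> Q ^+ (2 * m) * Q ^- 2 ^+ k = Q ^+ (2 * (m - k)).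
Proof.
move=> Q0 le_km; rewrite exprVn -exprM mulnBr expfB_cond ?(negPf Q0) //.
by rewrite add0n leq_mul2l.
Qed.

Lemma poch_num_neq0 (F : fieldType) (Q : F) N :
  Q != 0 -> (forall k, (0 < k)%N -> Q ^+ k != 1) ->
  poch (Q ^+ (2 * N)) (Q ^- 2) N != 0.
Proof.
move=> Q0 Q1; apply: poch_neq0 => k lt_kN.
by rewrite expr_mulVX ?(ltnW lt_kN) // Q1 // muln_gt0 subn_gt0.
Qed.

Lemma poch_base_neq0 (F : fieldType) (Q : F) N :
  (forall k, (0 < k)%N -> Q ^+ k != 1) -> poch Q Q N != 0.
Proof. by move=> Q1; apply: poch_neq0 => k _; rewrite -exprS Q1. Qed.

(** This is [kraw_rec] multiplied by [S / Q^N / (Q - Q^-1)]: with [c = - Q^(2N) / S^2] the factor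
    [X + c / X] becomes the q-bracket. *)
Lemma qker_rec (F : fieldType) (Q G S : F) N n x :
    Q != 0 -> (forall k, (0 < k)%N -> Q ^+ k != 1) -> G != 0 -> S != 0 ->
    (x <= N)%N ->
  (Q ^+ (2 * x) * S / Q ^+ N - Q ^+ N / (Q ^+ (2 * x) * S)) / (Q - Q^-1)
      * qker Q G S N n x
  = rec_up Q G S N n * qker Q G S N n.+1 x
    + rec_diag Q S N n * qker Q G S N n x
    + rec_down Q G S N n * qker Q G S N n.-1 x.
Proof.
move=> Q0 Q1 G0 S0 le_xN.
have QX k : Q ^+ k != 0 by rewrite expf_neq0.
have QQ : Q * Q - 1 != 0 by rewrite subr_eq0 -expr2 Q1.
have p0 : Q ^- 2 != 0 by rewrite invr_neq0.
have Q1' k : (0 < k)%N -> Q ^- 2 ^+ k != 1.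
  by move=> k0; rewrite exprVn -exprM invr_eq1 Q1 // muln_gt0.
have Xx : Q ^+ (2 * x) * Q ^- 2 ^+ x = 1 by rewrite expr_mulVX // subnn.
have := kraw_rec _ (Q ^- 2) (Q ^+ (2 * N)) (- (Q ^+ (2 * N) / S ^+ 2))
  (Q ^+ (2 * n)) (Q ^+ (2 * x)) N x p0 (QX _) (QX _) (poch_num_neq0 _ _ _ Q0 Q1)
  (poch_base_neq0 _ _ _ Q1') le_xN Xx.
rewrite /qker /rec_up /rec_diag /rec_down.
have -> : Q ^+ (2 * n) / Q ^- 2 = Q ^+ (2 * n.+1).
  by rewrite mulnS addnC exprD invrK.
set K := kraw _ _ _ _ => h.
(* At [n = 0] the truncated [n.-1] differs from the true shift [z * p], but the factor
   [1 - Q ^- (2 * n)] is zero there. *)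
have down : (1 - Q ^- (2 * n)) * G *
    ((- G) ^+ n.-1 * K (Q ^+ (2 * n.-1)) (Q ^+ (2 * x)))
   = - ((1 - Q ^- (2 * n)) *
    ((- G) ^+ n * K (Q ^+ (2 * n) * Q ^- 2) (Q ^+ (2 * x)))).
  case: (n) => [|k]; first by rewrite muln0 expr0 invr1 subrr !mul0r oppr0.
  have -> : Q ^+ (2 * k.+1) * Q ^- 2 = Q ^+ (2 * k).
    by rewrite mulnS addnC exprD mulfK.
  by rewrite [in (- G) ^+ k.+1]exprS /=; ring.
have assoc a b g t : a * b * g * t = a * (b * g * t) :> F by rewrite !mulrA.
rewrite (assoc (S^-1 * Q ^+ N / (Q - Q^-1))) {}down.
rewrite [(- G) ^+ n.+1]exprS; move: h.
move: (K _ _) (K _ _) (K _ _) => K0 K1 K2.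
have E2 k : Q ^+ (2 * k) = Q ^+ k ^+ 2 by rewrite mulnC exprM.
rewrite !E2.
move: (QX N) (QX x) (QX n) ((- G) ^+ n).
move: (Q ^+ N) (Q ^+ x) (Q ^+ n) => QN X Z QN0 X0 Z0 Gn h.
transitivity (S / QN / (Q - Q^-1) * Gn *
    ((X ^+ 2 + - (QN ^+ 2 / S ^+ 2) / X ^+ 2) * K2)).
  by field; rewrite X0 S0 Q0 QQ QN0.
by rewrite h; field; rewrite Z0 QN0 S0 G0 Q0 QQ.
Qed.

(** Dividing by [Q ^+ N] rescales the eigenvalue [Q^(2n)] of the difference equation to
    [Q^(2n-N)]. *)
Definition ev_down {F : fieldType} (Q T : F) (N y : nat) : F :=
  kraw_down (Q ^- 2) (Q ^+ (2 * N)) (- (Q ^+ (2 * N) / T ^+ 2))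
    (Q ^+ (2 * y)) / Q ^+ N.

Definition ev_up {F : fieldType} (Q T : F) (N y : nat) : F :=
  kraw_up (Q ^- 2) (Q ^+ (2 * N)) (- (Q ^+ (2 * N) / T ^+ 2))
    (Q ^+ (2 * y)) / Q ^+ N.

Lemma ev_down0 (F : fieldType) (Q T : F) N : ev_down Q T N 0 = 0.
Proof. by rewrite /ev_down /kraw_down muln0 expr0 subrr !mul0r. Qed.

Lemma ev_upN (F : fieldType) (Q T : F) N : Q != 0 -> ev_up Q T N N = 0.
Proof.
by move=> Q0; rewrite /ev_up /kraw_up divff ?expf_neq0 // subrr !(mul0r, mulr0).
Qed.

Definition qker_pred {F : fieldType} (Q G T : F) (N n y : nat) : F :=
  if y is y'.+1 then qker Q G T N n y' else 0.

Definition qker_succ {F : fieldType} (Q G T : F) (N n y : nat) : F :=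
  if (y < N)%N then qker Q G T N n y.+1 else 0.

Lemma qker_diff (F : fieldType) (Q G T : F) N n y :
    Q != 0 -> (forall k, (0 < k)%N -> Q ^+ k != 1) -> T != 0 ->
    (n <= N)%N -> (y <= N)%N ->
    Q ^+ (4 * y) * T ^+ 2 + Q ^+ (2 * N) * Q ^+ 2 != 0 ->
    Q ^+ (4 * y) * T ^+ 2 + Q ^+ (2 * N) != 0 ->
    Q ^+ (4 * y) * T ^+ 2 * Q ^+ 2 + Q ^+ (2 * N) != 0 ->
  ev_down Q T N y * qker_pred Q G T N n y
  + (Q ^- N - ev_down Q T N y - ev_up Q T N y) * qker Q G T N n y
  + ev_up Q T N y * qker_succ Q G T N n y
  = Q ^+ (2 * n) / Q ^+ N * qker Q G T N n y.
Proof.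
move=> Q0 Q1 T0 le_nN le_yN d2 d0 dm2.
have QX k : Q ^+ k != 0 by rewrite expf_neq0.
have p0 : Q ^- 2 != 0 by rewrite invr_neq0.
have Q1' k : (0 < k)%N -> Q ^- 2 ^+ k != 1.
  by move=> k0; rewrite exprVn -exprM invr_eq1 Q1 // muln_gt0.
have zn : Q ^+ (2 * n) * Q ^- 2 ^+ n = 1 by rewrite expr_mulVX // subnn.
(* [qker_pred] is 0 at [y = 0], where the series at [X * p] need not vanish; [ev_down] does. The
   same happens for [qker_succ] at [y = N]. *)
have -> : ev_down Q T N y * qker_pred Q G T N n y = ev_down Q T N y *
    ((- G) ^+ n * kraw (Q ^- 2) (Q ^+ (2 * N)) (- (Q ^+ (2 * N) / T ^+ 2)) N.+1
    (Q ^+ (2 * n)) (Q ^+ (2 * y) * Q ^- 2)).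
  case: (y) => [|k]; first by rewrite ev_down0 !mul0r.
  by rewrite mulnS addnC exprD mulfK.
have -> : ev_up Q T N y * qker_succ Q G T N n y = ev_up Q T N y *
    ((- G) ^+ n * kraw (Q ^- 2) (Q ^+ (2 * N)) (- (Q ^+ (2 * N) / T ^+ 2)) N.+1
    (Q ^+ (2 * n)) (Q ^+ (2 * y) / Q ^- 2)).
  rewrite /qker_succ; case: ltnP => [_|le_Ny].
    by rewrite /qker mulnS addnC exprD invrK.
  have -> : y = N by apply/eqP; rewrite eqn_leq le_yN.
  by rewrite ev_upN // !mul0r.
have X2 : Q ^+ (2 * y) ^+ 2 = Q ^+ (4 * y) by rewrite -exprM mulnAC.
have c2 : Q ^+ (2 * y) ^+ 2 - - (Q ^+ (2 * N) / T ^+ 2) != 0.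
  rewrite X2; apply: contra_neq d0 => /(congr1 ( *%R^~ (T ^+ 2))).
  by rewrite mul0r => <-; field.
have c2p : Q ^+ (2 * y) ^+ 2 - - (Q ^+ (2 * N) / T ^+ 2) * Q ^- 2 != 0.
  rewrite X2; apply: contra_neq dm2 => /(congr1 ( *%R^~ (T ^+ 2 * Q ^+ 2))).
  by rewrite mul0r => <-; field; rewrite Q0 T0.
have pc2 : Q ^- 2 * Q ^+ (2 * y) ^+ 2 - - (Q ^+ (2 * N) / T ^+ 2) != 0.
  rewrite X2; apply: contra_neq d2 => /(congr1 ( *%R^~ (T ^+ 2 * Q ^+ 2))).
  by rewrite mul0r => <-; field; rewrite Q0 T0.
have := kraw_diff _ (Q ^- 2) (Q ^+ (2 * N)) (- (Q ^+ (2 * N) / T ^+ 2))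
  (Q ^+ (2 * n)) (Q ^+ (2 * y)) N n p0 (QX _) c2 c2p pc2
  (poch_num_neq0 _ _ _ Q0 Q1) (poch_base_neq0 _ _ _ Q1') le_nN zn.
rewrite /ev_down /ev_up /qker.
move: (kraw_down _ _ _ _) (kraw_up _ _ _ _) => D B.
move: (kraw _ _ _ _ _ (_ * Q ^- 2)) => K0.
move: (kraw _ _ _ _ _ (_ / Q ^- 2)) => K1.
move: (kraw _ _ _ _ _ _) => K2.
move: (QX N) (Q ^+ N) (Q ^+ (2 * n)) ((- G) ^+ n) => QN0 QN Z Gn h.
transitivity (Gn / QN * (Z * K2)); last by ring.
by rewrite -h; ring.
Qed.

(** The later comparison of neighbouring coefficients sees the weight only through this ratio. *)
Lemma qweightS (F : fieldType) (Q : F) N n :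
    Q != 0 -> (forall k, (0 < k)%N -> Q ^+ k != 1) -> (n < N)%N ->
  qweight Q N n.+1 = qweight Q N n *
    (Q * Q ^+ n ^+ 2 * (1 - Q ^+ N ^+ 2 / Q ^+ n ^+ 2) /
     (Q ^+ N * (1 - Q ^+ 2 * Q ^+ n ^+ 2))).
Proof.
move=> Q0 Q1 lt_nN; rewrite /qweight.
have Q1' k : (0 < k)%N -> Q ^+ 2 ^+ k != 1.
  by move=> k0; rewrite -exprM Q1 // muln_gt0.
have -> : (N - n = (N - n.+1).+1)%N by rewrite subnSK.
have := poch_base_neq0 _ _ (N - n.+1).+1 Q1'.
have := poch_base_neq0 _ _ n.+1 Q1'.
rewrite !pochS -(exprS _ (N - n.+1)).
have -> : Q ^+ 2 * Q ^+ 2 ^+ n = Q ^+ 2 * Q ^+ n ^+ 2 by rewrite -!exprM mulnC.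
have -> : Q ^+ 2 ^+ (N - n.+1).+1 = Q ^+ N ^+ 2 / Q ^+ n ^+ 2.
  rewrite -!exprM subnSK // (mulnC N) (mulnC n) mulnBr.
  by rewrite expfB_cond ?(negPf Q0) ?add0n ?leq_mul2l ?(ltnW lt_nN).
have -> : Q ^+ (n.+1 * n.+1) = Q ^+ (n * n) * Q ^+ n ^+ 2 * Q.
  by rewrite -exprM -exprD -exprSr; congr (_ ^+ _); lia.
have -> : Q ^+ (n.+1 * N) = Q ^+ (n * N) * Q ^+ N by rewrite -exprD mulSnr.
have QX k : Q ^+ k != 0 by rewrite expf_neq0.
move: (QX N) (QX n) (QX (n * N)%N).
move: (Q ^+ N) (Q ^+ n) (Q ^+ (n * N)) (Q ^+ (n * n)).
move=> QN Z QnN Qnn QN0 Z0 QnN0.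
move: (poch _ _ N) (poch _ _ n) (poch _ _ (N - n.+1)) => PN Pn PNn.
rewrite !mulf_eq0 !negb_or => /andP[Pn0 qn] /andP[PNn0 qNn].
have qNn2 : Z ^+ 2 - QN ^+ 2 != 0.
  apply: contra_neq qNn => /(congr1 ( *%R^~ (Z ^- 2))).
  by rewrite mul0r => <-; field.
by field; rewrite exprMn qn QN0 Z0 qNn2 PNn0 Pn0 QnN0.
Qed.

(** * The relation over an arbitrary field *)

(* The half-integral powers of [q] in [Gs] and [Gt] only enter through their
   product. *)
Lemma qracah_relation (F : fieldType) (Q Gs Gt S T V : F) (N x y : nat) :
    Q != 0 -> (forall k, (0 < k)%N -> Q ^+ k != 1) -> S != 0 -> T != 0 ->
    V != 0 -> Gs != 0 -> Gt != 0 -> Gs * Gt * V * Q ^+ N = S * T ->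
    (x <= N)%N -> (y <= N)%N ->
    Q ^+ (4 * y) * T ^+ 2 + Q ^+ (2 * N) * Q ^+ 2 != 0 ->
    Q ^+ (4 * y) * T ^+ 2 + Q ^+ (2 * N) != 0 ->
    Q ^+ (4 * y) * T ^+ 2 * Q ^+ 2 + Q ^+ (2 * N) != 0 ->
  let r (g : nat -> F) :=
    \sum_(n < N.+1) qker Q Gs S N n x * g n * qweight Q N n in
  let br z := (z - z^-1) / (Q - Q^-1) in
  let vb := (V + V^-1) / (Q + Q^-1) in
  let Y := Q ^+ (2 * y) * T / Q ^+ N in
  let am := ev_down Q T N y in
  let ap := ev_up Q T N y in
  let a0 := Q ^- N - am - ap in
  let rm := r (fun n => qker_pred Q Gt T N n y) in
  let r0 := r (fun n => qker Q Gt T N n y) in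
  let rp := r (fun n => qker_succ Q Gt T N n y) in
  br (Q ^+ (2 * x) * S / Q ^+ N) * (am * rm + a0 * r0 + ap * rp) =
    am * br (Y * V / Q) * rm
    + (a0 * br Y * vb - br T * vb + br S) * r0
    + ap * br (Y / V * Q) * rp.
Proof.
move=> Q0 Q1 S0 T0 V0 Gs0 Gt0 GG le_xN le_yN d2 d0 dm2 r br vb Y am ap.
move=> a0 rm r0 rp.
have QX k : Q ^+ k != 0 by rewrite expf_neq0.
have QQ : Q * Q - 1 != 0 by rewrite subr_eq0 -expr2 Q1.
(* Otherwise [Q ^+ 4 - 1], a multiple of [Q * Q + 1], would vanish. *)
have QQ1 : Q * Q + 1 != 0.
  apply: contra_neq (Q1 4 isT) => h; apply/eqP; rewrite -subr_eq0; apply/eqP.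
  transitivity ((Q * Q + 1) * (Q * Q - 1)); first by ring.
  by rewrite h mul0r.
(* Cramer's rule for [al Q + be / Q = V] and [al / Q + be Q = V^-1], of determinant [Q^2 - Q^-2]. *)
pose al := (Q * V - (Q * V)^-1) / (Q ^+ 2 - Q ^- 2).
pose be := (Q / V - V / Q) / (Q ^+ 2 - Q ^- 2).
have QQ4 : (Q * Q) ^+ 2 - 1 != 0 by rewrite -expr2 -exprM subr_eq0 Q1.
have vbE : vb = al + be by rewrite /vb /al /be; field; rewrite Q0 QQ4 V0 QQ1.
have Y0 : Y != 0 by rewrite !mulf_neq0 ?invr_neq0.
(* Comparing the coefficients of [Y] and [Y^-1] gives back the two equations defining [al] and [be],
   here and in [brp]. *)
have brm : br (Y * V / Q) = al * br Y + be * br (Y / Q ^+ 2).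
  by rewrite /br /al /be; field; rewrite Q0 QQ4 V0 QQ Y0.
have brp : br (Y / V * Q) = al * br Y + be * br (Y * Q ^+ 2).
  by rewrite /br /al /be; field; rewrite Q0 QQ4 V0 QQ Y0.
have recE G U z n : G != 0 -> U != 0 -> (z <= N)%N ->
    br (Q ^+ (2 * z) * U / Q ^+ N) * qker Q G U N n z =
    rec_up Q G U N n * qker Q G U N n.+1 z + rec_diag Q U N n * qker Q G U N n z
    + rec_down Q G U N n * qker Q G U N n.-1 z.
  move=> G0 U0 le_zN; rewrite -qker_rec // /br !invfM invrK.
  by rewrite (mulrC _ (Q ^+ N)).
have upN G U : rec_up Q G U N N = 0.
  by rewrite /rec_up divff // subrr mulr0 mul0r oppr0.
have down0 G U : rec_down Q G U N 0 = 0.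
  by rewrite /rec_down muln0 expr0 invr1 subrr mulr0 mul0r.
have E2 k : Q ^+ (2 * k) = Q ^+ k ^+ 2 by rewrite mulnC exprM.
have E2S k : Q ^+ (2 * k.+1) = Q ^+ 2 * Q ^+ k ^+ 2 by rewrite mulnS exprD E2.
have GtE : Gt = S * T / (V * Q ^+ N * Gs).
  by rewrite -GG; field; rewrite V0 QX Gs0.
rewrite brm brp.
apply: etrans.
  apply: (bilinear_sum_relation F N (fun n => qker Q Gs S N n x)
  (fun n => qker_pred Q Gt T N n y) (fun n => qker Q Gt T N n y)
  (fun n => qker_succ Q Gt T N n y) (qweight Q N)
  (fun n => Q ^+ (2 * n) / Q ^+ N)
  (rec_up Q Gs S N) (rec_diag Q S N) (rec_down Q Gs S N)
  (rec_up Q Gt T N) (rec_diag Q T N) (rec_down Q Gt T N) r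
  (br (Q ^+ (2 * x) * S / Q ^+ N)) (br (Y / Q ^+ 2)) (br Y) (br (Y * Q ^+ 2))
  am a0 ap al be (br S - br T * vb)) => //.
- by move=> n _; exact: recE.
- move=> n _; rewrite /am /Y; case: (y) le_yN => [|z] le_zN.
    by rewrite ev_down0 !mul0r.
  have -> : Q ^+ (2 * z.+1) * T / Q ^+ N / Q ^+ 2 = Q ^+ (2 * z) * T / Q ^+ N.
    by rewrite mulnS exprD; field; rewrite QX Q0.
  by rewrite /qker_pred (recE Gt T z n) // ltnW.
- by move=> n _; exact: recE.
- move=> n _; rewrite /ap /qker_succ; case: ltnP => [lt_yN|le_Ny].
    have -> : Y * Q ^+ 2 = Q ^+ (2 * y.+1) * T / Q ^+ N.
      by rewrite /Y mulnS exprD; field; rewrite QX.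
    by rewrite (recE Gt T y.+1 n).
  have -> : y = N by apply/eqP; rewrite eqn_leq le_yN.
  by rewrite ev_upN // !mul0r.
- by move=> n le_nN; exact: qker_diff.
(* The eigenvalue [Q^(2n-N)] cancels the power of [Q] in [rec_diag], so both sides are constant in
   [n]; this forces the choice [br S - br T * vb] of [kappa]. *)
- move=> n le_nN; rewrite vbE /rec_diag /br.
  by field; rewrite Q0 QQ T0 S0 !QX.
- move=> n lt_nN; rewrite qweightS // /rec_up /rec_down GtE !E2S !E2.
  move: (qweight _ _ _) (QX N) (QX n) => w; rewrite /al /be.
  have := Q1 (2 * n.+1)%N isT; rewrite E2S eq_sym -subr_eq0.
  move: (Q ^+ N) (Q ^+ n) => QN Z QZ QN0 Z0.
  by field; rewrite Gs0 QN0 V0 Z0 Q0 QQ T0 QQ4 exprMn QZ.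
- move=> n lt_nN; rewrite qweightS // /rec_up /rec_down GtE !E2S !E2.
  move: (qweight _ _ _) (QX N) (QX n) => w; rewrite /al /be.
  have := Q1 (2 * n.+1)%N isT; rewrite E2S eq_sym -subr_eq0.
  move: (Q ^+ N) (Q ^+ n) => QN Z QZ QN0 Z0.
  by field; rewrite Gs0 QN0 V0 T0 S0 Z0 Q0 QQ QQ4 exprMn QZ.
by rewrite vbE; congr (_ + _ * _ + _); ring.
Qed.

(** * The complex power [q^z] *)

Lemma expCD (R : realType) (a b : R[i]) : expC (a + b) = expC a * expC b.
Proof.
case: a b => [a1 a2] [b1 b2]; rewrite /expC /= expRD cosD sinD.
apply/eqP; rewrite eq_complex /=; apply/andP; split; apply/eqP; ring.
Qed.

Lemma qpowD (R : realType) (q : R) (a b : R[i]) :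
  qpow q (a + b) = qpow q a * qpow q b.
Proof. by rewrite /qpow mulrDl expCD. Qed.

Lemma qpow_real (R : realType) (q : R) (z : R[i]) :
  complex.Im z = 0 -> qpow q z = (expR (complex.Re z * ln q))%:C.
Proof.
case: z => a b /= ->; rewrite /qpow /expC /= !(mulr0, mul0r, subr0, addr0).
by rewrite cos0 sin0 mulr1.
Qed.

Lemma qpow0 (R : realType) (q : R) : qpow q 0 = 1.
Proof. by rewrite qpow_real //= mul0r expR0. Qed.

Lemma qpow_neq0 (R : realType) (q : R) (z : R[i]) : qpow q z != 0.
Proof.
apply/eqP => z0; have /eqP := qpow0 _ q.
by rewrite -(subrr z) qpowD z0 mul0r eq_sym oner_eq0.
Qed.

Lemma qpowN (R : realType) (q : R) (z : R[i]) : qpow q (- z) = (qpow q z)^-1.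
Proof.
apply: (mulfI (qpow_neq0 _ q z)).
by rewrite -qpowD subrr qpow0 divff ?qpow_neq0.
Qed.

Lemma qpowMn (R : realType) (q : R) (z : R[i]) n :
  qpow q (n%:R * z) = qpow q z ^+ n.
Proof.
elim: n => [|n IHn]; first by rewrite mul0r qpow0.
by rewrite -addn1 natrD mulrDl mul1r qpowD IHn addn1 exprSr.
Qed.

Lemma qpow1 (R : realType) (q : R) : 0 < q -> qpow q 1 = q%:C.
Proof. by move=> q0; rewrite qpow_real //= mul1r lnK. Qed.

Lemma qpow_nat (R : realType) (q : R) n : 0 < q -> qpow q n%:R = q%:C ^+ n.
Proof. by move=> q0; rewrite -[n%:R]mulr1 qpowMn qpow1. Qed.

Lemma qpow_2nat (R : realType) (q : R) n :
  0 < q -> qpow q (2 * n%:R) = q%:C ^+ (2 * n).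
Proof. by move=> q0; rewrite -natrM qpow_nat. Qed.

(** * Translation of the kernels, weight and coefficients *)

(** The sum may run up to [N] instead of [minn n x]: for larger [j] one of the products starting at
    [q^(2n)] and [q^(2x)] contains a zero factor. *)
Lemma kfunE (R : realType) (q : R) N (u s : R[i]) n x :
    0 < q -> (n <= N)%N -> (x <= N)%N ->
  kfun q N u s n x =
    qker q%:C (qpow q (s - u - 2^-1 * N%:R + 2^-1)) (qpow q s) N n x.
Proof.
move=> q0 le_nN le_xN; rewrite /kfun /qker qpowMn -exprMn mulN1r; congr (_ * _).
have Q0 : q%:C != 0 :> R[i] by rewrite -qpow1 // qpow_neq0.
have le_min : ((minn n x).+1 <= N.+1)%N by rewrite ltnS geq_min le_nN.
have cE : - qpow q (- (2 * x%:R) - 2 * s + 2 * N%:R)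
    = - (q%:C ^+ (2 * N) / qpow q s ^+ 2) / q%:C ^+ (2 * x).
  rewrite !qpowD !qpowN !qpow_2nat // qpowMn mulNr; congr (- _).
  by rewrite mulrC mulrA mulrAC.
rewrite cE !qpow_2nat //; set c := - (_ / _).
pose F j := poch (q%:C ^+ (2 * n)) (q%:C ^- 2) j *
  poch (q%:C ^+ (2 * x)) (q%:C ^- 2) j *
  poch (c / q%:C ^+ (2 * x)) (q%:C ^- 2) j /
  (poch (q%:C ^+ (2 * N)) (q%:C ^- 2) j * poch (q%:C ^- 2) (q%:C ^- 2) j) *
  q%:C ^- 2 ^+ j.
transitivity (\sum_(j < (minn n x).+1) F j).
  by apply: eq_bigr => j _; rewrite qpowN qpow_2nat // /F [in RHS]exprVn -exprM.
rewrite (big_ord_widen _ F le_min) big_mkcond; apply: eq_bigr => j _.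
case: ifPn => //; rewrite /F.
rewrite -leqNgt gtn_min => /orP[lt_nj|lt_xj].
  rewrite (poch_eq0 _ (q%:C ^+ (2 * n)) _ j n) ?mul0r //.
  by rewrite expr_mulVX ?subnn.
rewrite (poch_eq0 _ (q%:C ^+ (2 * x)) _ j x) ?mulr0 ?mul0r //.
by rewrite expr_mulVX ?subnn.
Qed.

Lemma wfunE (R : realType) (q : R) N n : 0 < q -> wfun q N n = qweight q%:C N n.
Proof.
move=> q0; rewrite /wfun /qweight /qbinom; congr (_ * _).
by rewrite qpowMn qpowD qpowN !qpow_nat // exprMn exprVn -!exprM (mulnC N).
Qed.

Lemma denE (R : realType) (q : R) N y (t c : R[i]) : 0 < q ->
  den q N y t c =
    1 + q%:C ^+ (2 * N) * qpow q c / (q%:C ^+ (4 * y) * qpow q t ^+ 2).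
Proof.
move=> q0; rewrite /den !qpowD !qpowN -natrM qpow_nat // qpow_2nat // qpowMn.
by rewrite -invfM [_ * q%:C ^+ _]mulrC [RHS]addrC [LHS]addrC mulrAC.
Qed.

(** For real [t] every power of [q] involved is a positive real, so each denominator is 1 plus a
    positive number. *)
Lemma nonvanishing_den_real (R : realType) (q : R) N y (t : R[i]) :
  0 < q -> complex.Im t = 0 -> nonvanishing_den q N y t.
Proof.
move=> q0 t0.
have pos z : complex.Im z = 0 -> 0 < qpow q z.
  by move=> z0; rewrite qpow_real // ltcR expR_gt0.
have Qp k : 0 < q%:C ^+ k :> R[i] by rewrite exprn_gt0 // ltcR.
have dp c : complex.Im c = 0 -> den q N y t c != 0.
  move=> c0; rewrite denE // gt_eqF // addr_gt0 // divr_gt0 // mulr_gt0 ?pos //.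
  by rewrite exprn_gt0 // pos.
by split; apply: dp; rewrite /= ?(addr0, oppr0).
Qed.

Lemma add_neq0_div (F : fieldType) (a b : F) :
  a != 0 -> 1 + b / a != 0 -> a + b != 0.
Proof.
move=> a0; apply: contra_neq => ab.
by rewrite -(divff a0) -mulrDl ab mul0r.
Qed.

Lemma den_num_neq0 (R : realType) (q : R) N y (t : R[i]) :
    0 < q -> nonvanishing_den q N y t ->
  [/\ q%:C ^+ (4 * y) * qpow q t ^+ 2 + q%:C ^+ (2 * N) * q%:C ^+ 2 != 0,
      q%:C ^+ (4 * y) * qpow q t ^+ 2 + q%:C ^+ (2 * N) != 0 &
      q%:C ^+ (4 * y) * qpow q t ^+ 2 * q%:C ^+ 2 + q%:C ^+ (2 * N) != 0].
Proof.
move=> q0 [].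
have QX k : q%:C ^+ k != 0 :> R[i] by rewrite expf_neq0 // -qpow1 // qpow_neq0.
rewrite !denE // qpowN qpow0 mulr1 !(qpow_nat _ q 2) //.
have: q%:C ^+ (4 * y) * qpow q t ^+ 2 != 0.
  by rewrite mulf_neq0 // expf_neq0 // qpow_neq0.
move: (_ * qpow q t ^+ 2) => a a0.
move=> /(add_neq0_div _ _ _ a0) d2 /(add_neq0_div _ _ _ a0) d0.
move=> /(add_neq0_div _ _ _ a0) dm2; split=> //.
have -> : q%:C ^+ (2 * N) = q%:C ^+ (2 * N) / q%:C ^+ 2 * q%:C ^+ 2 :> R[i].
  by rewrite divfK.
by rewrite -mulrDl mulf_neq0.
Qed.

(** For [X = q^(2y)], [p = q^-2] and [c = - q^(2N-2t)], the denominators [1 - c / X^2] and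
    [1 - c / (p X^2)] are [den] at 0 and 2; in [a_1E], [1 - c p / X^2] is [den] at -2. *)
Lemma a_m1E (R : realType) (q : R) N y (t : R[i]) :
  0 < q -> nonvanishing_den q N y t ->
  a_m1 q N y t = ev_down q%:C (qpow q t) N y.
Proof.
move=> q0 nz; have [d2 d0 _] := den_num_neq0 _ _ _ _ _ q0 nz.
have Q0 : q%:C != 0 :> R[i] by rewrite -qpow1 // qpow_neq0.
have QX k : q%:C ^+ k != 0 :> R[i] by rewrite expf_neq0.
have T0 : qpow q t != 0 := qpow_neq0 _ _ _.
rewrite /a_m1 /ev_down /kraw_down !denE // (qpowD _ q _ 2) !(qpow_nat _ q 2) //.
rewrite !qpowD !qpowN -!natrM !qpow_nat // qpowMn qpow0.
move: d2 d0 (QX N) (QX y); rewrite !(mulnC _ N) !(mulnC _ y) !exprM.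
move: (q%:C ^+ N) (q%:C ^+ y) => QN X.
move: (q%:C) (qpow q t) Q0 T0 => Q T Q0 T0 d2 d0 QN0 X0.
have e2 : T ^+ 2 * X ^+ 4 - - QN ^+ 2 * Q ^+ 2 =
    X ^+ 4 * T ^+ 2 + QN ^+ 2 * Q ^+ 2 by ring.
have e0 : (T * X ^+ 2) ^+ 2 - - QN ^+ 2 = X ^+ 4 * T ^+ 2 + QN ^+ 2 by ring.
by field; rewrite e2 e0 QN0 Q0 X0 T0 d2 d0.
Qed.

Lemma a_1E (R : realType) (q : R) N y (t : R[i]) :
  0 < q -> nonvanishing_den q N y t ->
  a_1 q N y t = ev_up q%:C (qpow q t) N y.
Proof.
move=> q0 nz; have [_ d0 dm2] := den_num_neq0 _ _ _ _ _ q0 nz.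
have Q0 : q%:C != 0 :> R[i] by rewrite -qpow1 // qpow_neq0.
have QX k : q%:C ^+ k != 0 :> R[i] by rewrite expf_neq0.
have T0 : qpow q t != 0 := qpow_neq0 _ _ _.
rewrite /a_1 /ev_up /kraw_up !denE // !qpowD !qpowN -!natrM.
rewrite !qpow_nat // qpowMn qpow0.
move: d0 dm2 (QX N) (QX y); rewrite !(mulnC _ N) !(mulnC _ y) !exprM.
move: (q%:C ^+ N) (q%:C ^+ y) => QN X.
move: (q%:C) (qpow q t) Q0 T0 => Q T Q0 T0 d0 dm2 QN0 X0.
have em2 : (T * Q * X ^+ 2) ^+ 2 - - QN ^+ 2 =
    X ^+ 4 * T ^+ 2 * Q ^+ 2 + QN ^+ 2 by ring.
have e0 : (T * X ^+ 2) ^+ 2 - - QN ^+ 2 = X ^+ 4 * T ^+ 2 + QN ^+ 2 by ring.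
by field; rewrite em2 e0 QN0 X0 Q0 T0 dm2 d0.
Qed.

(** * Specialisation to complex powers of [q] *)

Theorem corollary3p9 (R : realType) (q : R) (N x y : nat) (s t v : R[i])
    (q_gt0 : 0 < q) (q_neq1 : q != 1) (le_xN : (x <= N)%N) (le_yN : (y <= N)%N) :
  (complex.Im t = 0 -> nonvanishing_den q N y t) /\
  (nonvanishing_den q N y t ->
   [/\ y = 0%N -> a_m1 q N y t = 0 /\ b_m1 q N y t v = 0,
       y = N -> a_1 q N y t = 0 /\ b_1 q N y t v = 0
     & qbracket q (2 * x%:R - N%:R + s) *
         (a_m1 q N y t * Rr_pred q N s t v x y
          + a_0 q N y t * Rr q N s t v x y
          + a_1 q N y t * Rr_succ q N s t v x y)
       = b_m1 q N y t v * Rr_pred q N s t v x y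
         + (b_0 q N y t v + qbracket q s) * Rr q N s t v x y
         + b_1 q N y t v * Rr_succ q N s t v x y]).
Proof.
have qC0 : q%:C != 0 :> R[i] by rewrite -qpow1 // qpow_neq0.
split=> [t_real|nz]; first exact: nonvanishing_den_real.
have qC1 k : (0 < k)%N -> q%:C ^+ k != 1 :> R[i].
  move=> k_gt0; rewrite -rmorphXn /= -[1]/(1%:C) (inj_eq (@complexI _)).
  by rewrite pexpr_eq1 // ltW.
split=> [y0|yN|].
- have a0 : a_m1 q N y t = 0 by rewrite a_m1E // y0 ev_down0.
  by rewrite /b_m1 a0 mul0r.
- have a0 : a_1 q N y t = 0 by rewrite a_1E // yN ev_upN.
  by rewrite /b_1 a0 mul0r.
have [d2 d0 dm2] := den_num_neq0 _ _ _ _ _ q_gt0 nz.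
pose G u z := qpow q (z - u - 2^-1 * N%:R + 2^-1).
have half : 2^-1 + 2^-1 = 1 :> R[i] by field.
(* The exponents of the two [G] factors add up to [s + t - v - N]: the halves combine and cancel the
   shift by [u = 1]. *)
have GG : G 1 s * G v t * qpow q v * q%:C ^+ N = qpow q s * qpow q t.
  rewrite -qpow_nat // -!qpowD; congr qpow.
  transitivity (s + t - 1 + (2^-1 + 2^-1) * (1 - N%:R) + N%:R); first by ring.
  by rewrite half; ring.
have Rr_sum z : (z <= N)%N -> Rr q N s t v x z = \sum_(n < N.+1)
    qker q%:C (G 1 s) (qpow q s) N n x * qker q%:C (G v t) (qpow q t) N n z *
    qweight q%:C N n.
  by move=> le_zN; apply: eq_bigr => n _; rewrite !kfunE ?wfunE // -ltnS.
(* At [y = 0] the omitted term is the sum with the zero kernel, so one formula covers the end of the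
   range; [succE] does this at [y = N]. *)
have predE : Rr_pred q N s t v x y = \sum_(n < N.+1)
    qker q%:C (G 1 s) (qpow q s) N n x *
    qker_pred q%:C (G v t) (qpow q t) N n y * qweight q%:C N n.
  rewrite /Rr_pred /qker_pred; case: (y) le_yN => [|z] le_zN.
    by rewrite big1 // => n _; rewrite mulr0 mul0r.
  exact: Rr_sum (ltnW le_zN).
have succE : Rr_succ q N s t v x y = \sum_(n < N.+1)
    qker q%:C (G 1 s) (qpow q s) N n x *
    qker_succ q%:C (G v t) (qpow q t) N n y * qweight q%:C N n.
  rewrite /Rr_succ /qker_succ; case: ltnP => [lt_yN|_]; first exact: Rr_sum.
  by rewrite big1 // => n _; rewrite mulr0 mul0r.
rewrite /b_m1 /b_0 /b_1 /a_0 predE succE Rr_sum // a_m1E // a_1E //.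
rewrite /qbracket /qbrace !qpowN !(qpowD, qpowN) !qpow_2nat // !qpow_nat //.
rewrite qpow1 //.
rewrite ![q%:C ^+ (2 * _) / q%:C ^+ N * _]mulrAC.
exact: qracah_relation _ q%:C (G 1 s) (G v t) (qpow q s) (qpow q t) (qpow q v)
  N x y qC0 qC1 (qpow_neq0 _ _ _) (qpow_neq0 _ _ _) (qpow_neq0 _ _ _)
  (qpow_neq0 _ _ _) (qpow_neq0 _ _ _) GG le_xN le_yN d2 d0 dm2.
Qed.
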